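(* If $m,n \geq 1$ are integers, then $\gamma(H_{m,n}) \leq n(m+1) + m$.
   Context: The infinite truncated square tiling graph $H_{\infty,\infty}$ has vertex set $\{(a,(x,y)) : a\in\mathbb{Z}_4,\ (x,y)\in\mathbb{Z}^2\}$. Its edges are: $(a,(x,y))\sim(a+1,(x,y))$ with $a+1$ taken modulo 4 (so each $(x,y)$ carries a 4-cycle whose vertices $0,1,2,3$ are its top, right, bottom, left vertices); $(1,(x,y))\sim(3,(x+1,y))$; and $(0,(x,y))\sim(2,(x,y+1))$. For $(x,y)\in\mathbb{Z}^2$ the octagon $O_{x,y}$ is the 8-cycle through $(0,(x,y)),(1,(x,y)),(3,(x+1,y)),(0,(x+1,y)),(2,(x+1,y+1)),(3,(x+1,y+1)),(1,(x,y+1)),(2,(x,y+1))$, in this cyclic order. For positive integers $m,n$, $H_{m,n}$ is the finite subgraph consisting of $m$ rows of $n$ octagons each: the union of the octagons $O_{x,y}$ with $0\le x\le n-1$, $0\le y\le m-1$. $\gamma(G)$ denotes the domination number of a finite graph $G$: the smallest cardinality of a set $T$ of vertices such that every vertex of $G$ is in $T$ or adjacent to a vertex of $T$. *)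

(* Defs.v *)
From mathcomp Require Import all_boot all_order all_algebra.

Set Implicit Arguments.
Unset Strict Implicit.
Unset Printing Implicit Defensive.

Import GRing.Theory.

(* A finite graph is a symmetric irreflexive relation [e] on a finType. *)

Definition dominating (T : finType) (e : rel T) (D : {set T}) : bool :=
  [forall v, (v \in D) || [exists u in D, e u v]].

Lemma dominating_setT (T : finType) (e : rel T) : dominating e [set: T].
Proof. by apply/forallP => v; rewrite inE. Qed.

Definition domination_number (T : finType) (e : rel T) : nat :=
  #|[arg min_(D < [set: T] | dominating e D) #|D|]%N|.

Lemma domination_numberP (T : finType) (e : rel T) :
  (exists2 D : {set T}, dominating e D & #|D| = domination_number e) /\
  (forall D : {set T}, dominating e D -> (domination_number e <= #|D|)%N).
Proof.
rewrite /domination_number; case: arg_minnP => [|D domD minD].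
  exact: dominating_setT.
by split=> //; exists D.
Qed.

Notation tst_vertex := ('Z_4 * (int * int))%type.

Section TruncatedSquareTiling.
Local Open Scope ring_scope.

(* The infinite graph H_{oo,oo}: each edge in one orientation, then the
   symmetric closure. *)
Definition tst_arc : rel tst_vertex := fun u v =>
  let: (a, (x, y)) := u in
  [|| v == (a + 1, (x, y)),
      (a == 0) && (v == (2, (x, y + 1)))
    | (a == 1) && (v == (3, (x + 1, y)))].

Definition tst_edge : rel tst_vertex := fun u v => tst_arc u v || tst_arc v u.

Definition octagon (x y : int) : seq tst_vertex :=
  [:: (0, (x, y)); (1, (x, y)); (3, (x + 1, y)); (0, (x + 1, y));
      (2, (x + 1, y + 1)); (3, (x + 1, y + 1)); (1, (x, y + 1));
      (2, (x, y + 1))].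

Definition octagon_edge (x y : int) : rel tst_vertex := fun u v =>
  let s := octagon x y in
  (u \in s) && (v == next s u) || (v \in s) && (u == next s v).

End TruncatedSquareTiling.

Lemma octagon_ucycle x y : ucycle tst_edge (octagon x y).
Proof.
rewrite /ucycle /= /tst_edge /tst_arc !inE !xpair_eqE !eqxx /=.
have E (z : int) : (z + 1 == z)%R = false by rewrite -[X in _ == X]addr0 (inj_eq (addrI z)).
have E' (z : int) : (z == z + 1)%R = false by rewrite eq_sym E.
by rewrite !E !E' /= ?orbT ?andbF.
Qed.

Lemma octagon_edge_sub x y : subrel (octagon_edge x y) tst_edge.
Proof.
have [cyc_s _] := andP (octagon_ucycle x y).
have sym u v : tst_edge u v = tst_edge v u by rewrite /tst_edge orbC.
move=> u v /orP[] /andP[us /eqP->]; last rewrite sym; exact: next_cycle.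
Qed.

(* H_{m,n} is the union, as a graph, of the octagons O_{x,y} with x < n and
   y < m: its vertices and its edges are those of these octagons. *)
Definition H_vertices (m n : nat) : seq tst_vertex :=
  flatten [seq octagon x%:Z y%:Z | y <- iota 0 m, x <- iota 0 n].

Definition H_vertex (m n : nat) : finType := seq_sub (H_vertices m n).

Definition H_edge (m n : nat) : rel (H_vertex m n) := fun u v =>
  [exists y : 'I_m, exists x : 'I_n,
     octagon_edge (x : nat)%:Z (y : nat)%:Z (val u) (val v)].

Lemma H_edge_sym m n : symmetric (@H_edge m n).
Proof.
by move=> u v; apply: eq_existsb => y; apply: eq_existsb => x; rewrite /octagon_edge orbC.
Qed.

Lemma H_edge_irrefl m n : irreflexive (@H_edge m n).
Proof.
move=> u; apply: contraTF isT => /existsP[y /existsP[x /octagon_edge_sub]].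
rewrite /tst_edge orbb /tst_arc; case: (val u) => a [i j].
rewrite !xpair_eqE => /or3P[].
- by case/andP => /eqP; case: a => -[|[|[|[|]]]].
- by case/and3P => /eqP ->.
- by case/and3P => /eqP ->.
Qed.

(* Main.v *)
Require Import Defs.
From mathcomp Require Import all_boot all_order all_algebra.

(** Index the 4-cycles meeting [H_{m,n}] by [0 <= x <= n], [0 <= y <= m]. The
    dominating set takes one vertex from each of these [(m+1)(n+1)] 4-cycles
    except one: the top vertex [0] of every 4-cycle with [y < m], and, in the
    last row [y = m], where there is no top vertex, the left vertex [3] of every
    4-cycle with [x >= 1].

    A top vertex dominates the left and right vertices of its 4-cycle and the
    bottom vertex of the 4-cycle above it, so that in the rows [y < m] nothing is
    missed: in row [0] there is no bottom vertex. In row [m] the bottom vertices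
    are dominated from below, and the left vertex of the 4-cycle at [x + 1]
    dominates the right vertex of the one at [x]. This takes care of the corner
    [(0, m)], from which no vertex was taken, and gives a set of
    [m(n+1) + n = n(m+1) + m] vertices.

    The edges used must belong to octagons of [H_{m,n}], so the verification is
    done octagon by octagon (lemma [octagon_dominated]): the two top vertices on
    the lower half of an octagon dominate all of it except the two vertices on
    its uppermost edge; these lie on the lowest edge of the octagon above, or
    are handled by the last row of the dominating set. *)

Import GRing.Theory.

Set Implicit Arguments.
Unset Strict Implicit.
Unset Printing Implicit Defensive.

Local Open Scope ring_scope.

Lemma card_seq_sub_mem_le (T : choiceType) (s r : seq T) :
  (#|[set v : seq_sub s | val v \in r]| <= size r)%N.
Proof.
rewrite cardE -(size_map val); apply: uniq_leq_size.
  by rewrite (map_inj_uniq val_inj) enum_uniq.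
by move=> _ /mapP[v + ->]; rewrite mem_enum inE.
Qed.

Definition octagon_nth (x y : int) (i : nat) : tst_vertex :=
  nth (0, (x, y)) (octagon x y) i.

Lemma octagon_edge_sym x y : symmetric (octagon_edge x y).
Proof. by move=> u v; rewrite /octagon_edge orbC. Qed.

(** Stated by positions along the cycle, so that no two vertices with symbolic
    coordinates ever have to be compared. *)
Lemma octagon_edge_nth x y i : (i < 8)%N ->
  octagon_edge x y (octagon_nth x y i) (octagon_nth x y (i.+1 %% 8)).
Proof.
move=> lt_i8; have [_ uniq_s] := andP (octagon_ucycle x y).
have mem_i : octagon_nth x y i \in octagon x y by exact: mem_nth.
rewrite /octagon_edge mem_i next_nth mem_i index_uniq //=.
case: i lt_i8 {mem_i} => [|[|[|[|[|[|[|[|//]]]]]]]] _; by rewrite /= eqxx.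
Qed.

Definition dominating_seq (m n : nat) : seq tst_vertex :=
  [seq (0, (x%:Z, y%:Z)) | y <- iota 0 m, x <- iota 0 n.+1] ++
  [seq (3, (x%:Z, m%:Z)) | x <- iota 1 n].

Lemma size_dominating_seq m n : size (dominating_seq m n) = (n * (m + 1) + m)%N.
Proof.
rewrite size_cat size_allpairs size_map !size_iota addn1 !mulnS mulnC.
by rewrite -addnA addnC (addnC n).
Qed.

Lemma top_in_dominating_seq m n x y : (x <= n)%N -> (y < m)%N ->
  (0, (x%:Z, y%:Z)) \in dominating_seq m n.
Proof.
move=> le_xn lt_ym; rewrite mem_cat; apply/orP; left.
by apply/allpairsP; exists (y, x); rewrite !mem_iota.
Qed.

Lemma left_in_dominating_seq m n x : (x < n)%N ->
  (3, (x.+1%:Z, m%:Z)) \in dominating_seq m n.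
Proof.
by move=> lt_xn; rewrite mem_cat map_f ?orbT // mem_iota /= add1n ltnS.
Qed.

Definition dominated (m n : nat) (v : tst_vertex) : Prop :=
  v \in dominating_seq m n \/
  exists x y : nat, [/\ (x < n)%N, (y < m)%N &
    exists2 u, u \in dominating_seq m n & octagon_edge x%:Z y%:Z u v].

(** Along the octagon, positions [0] and [3] are top vertices of 4-cycles of row
    [y], and dominate their neighbours at positions [7], [1], [2] and [4]. If
    [y + 1 = m], position [5] is a left vertex of the last row and dominates
    position [6]; otherwise both are found again in the octagon above. *)
Lemma octagon_dominated m n x y i : (x < n)%N -> (y < m)%N -> (i < 8)%N ->
  dominated m n (octagon_nth x%:Z y%:Z i).
Proof.
move=> lt_xn lt_ym lt_i8.
have intS (k : nat) : k%:Z + 1 = k.+1%:Z by rewrite -addn1 PoszD.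
have after z j : (z < m)%N -> (j < 8)%N ->
    octagon_nth x%:Z z%:Z j \in dominating_seq m n ->
  dominated m n (octagon_nth x%:Z z%:Z (j.+1 %% 8)).
  move=> lt_zm lt_j8 Dj; right; exists x, z; split=> //.
  by exists (octagon_nth x%:Z z%:Z j) => //; exact: octagon_edge_nth.
have before z j : (z < m)%N -> (j < 8)%N ->
    octagon_nth x%:Z z%:Z (j.+1 %% 8) \in dominating_seq m n ->
  dominated m n (octagon_nth x%:Z z%:Z j).
  move=> lt_zm lt_j8 Dj; right; exists x, z; split=> //.
  exists (octagon_nth x%:Z z%:Z (j.+1 %% 8)) => //.
  by rewrite octagon_edge_sym octagon_edge_nth.
have D0 z : (z < m)%N -> octagon_nth x%:Z z%:Z 0 \in dominating_seq m n.
  by move=> lt_zm; rewrite top_in_dominating_seq // ltnW.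
have D3 z : (z < m)%N -> octagon_nth x%:Z z%:Z 3 \in dominating_seq m n.
  by move=> lt_zm; rewrite /octagon_nth /= intS top_in_dominating_seq.
have dom1 z (lt_zm : (z < m)%N) := after z 0 lt_zm isT (D0 z lt_zm).
have dom2 z (lt_zm : (z < m)%N) := before z 2 lt_zm isT (D3 z lt_zm).
have D5 : y.+1 = m -> octagon_nth x%:Z y%:Z 5 \in dominating_seq m n.
  by move=> eq_ym; rewrite /octagon_nth /= !intS eq_ym left_in_dominating_seq.
have last_row : (y.+1 == m) || (y.+1 < m)%N by rewrite -leq_eqVlt.
case: i lt_i8 => [|[|[|[|[|[|[|[|//]]]]]]]] _.
- by left; exact: D0.
- exact: dom1.
- exact: dom2.
- by left; exact: D3.
- exact: (after y 3 lt_ym isT (D3 y lt_ym)).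
- case/orP: last_row => [/eqP eq_ym | lt_Sym]; first by left; exact: D5.
  (* Vertices 5 and 6 of an octagon are vertices 2 and 1 of the one above. *)
  by have := dom2 _ lt_Sym; rewrite /octagon_nth /= !intS.
- case/orP: last_row => [/eqP eq_ym | lt_Sym].
    exact: (after y 5 lt_ym isT (D5 eq_ym)).
  by have := dom1 _ lt_Sym; rewrite /octagon_nth /= !intS.
- exact: (before y 7 lt_ym isT (D0 y lt_ym)).
Qed.

Lemma dominating_seq_dominating m n :
  dominating (@H_edge m n) [set v | val v \in dominating_seq m n].
Proof.
apply/forallP => v; rewrite inE.
have : dominated m n (val v).
  have /flattenP[s /allpairsP[[y x] [/= y_in x_in ->]] v_in] := valP v.
  rewrite mem_iota /= in y_in; rewrite mem_iota /= in x_in.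
  rewrite -(nth_index (0, (x%:Z, y%:Z)) v_in).
  by apply: octagon_dominated => //; rewrite -index_mem in v_in.
case=> [-> // | [x [y [lt_xn lt_ym [u Du uv]]]]]; apply/orP; right.
have u_oct : u \in octagon x%:Z y%:Z.
  by case/orP: uv => /andP[// v_in /eqP->]; rewrite mem_next.
have Hu : u \in H_vertices m n.
  apply/flattenP; exists (octagon x%:Z y%:Z) => //.
  by apply/allpairsP; exists (y, x); rewrite !mem_iota.
apply/existsP; exists (SeqSub Hu); rewrite inE Du /=.
by apply/existsP; exists (Ordinal lt_ym); apply/existsP; exists (Ordinal lt_xn).
Qed.

Local Close Scope ring_scope.

Theorem theorem2p8 (m n : nat) (hm : (1 <= m)%N) (hn : (1 <= n)%N) :
  (domination_number (@H_edge m n) <= n * (m + 1) + m)%N.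
Proof.
have [_ min_dom] := domination_numberP (@H_edge m n).
rewrite -size_dominating_seq.
exact: leq_trans (min_dom _ (dominating_seq_dominating m n)) (card_seq_sub_mem_le _ _).
Qed.
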